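(* Let $G$ be a group. Then $G$ is diffuse if and only if for every nontrivial finitely generated subgroup $F$ of $G$ there exists a homomorphism $F \to H$ onto a nontrivial diffuse group $H$.
   Context: For a finite subset $A$ of a group $G$, write $A^{-1} = \{a^{-1} \mid a \in A\}$. An \emph{extreme point} of $A$ is an element $a \in A$ such that $a^{-1}A \cap A^{-1}a = \{id\}$. A group $G$ is \emph{diffuse} if every finite subset $A \subset G$ with $|A| > 1$ has (at least) two extreme points. (The definition is made for torsion-free groups, so diffuse groups are torsion free.) *)

(* Defs.v *)
From HB Require Import structures.
From mathcomp Require Import all_boot.
From mathcomp Require Import finmap.

Set Implicit Arguments.
Unset Strict Implicit.
Unset Printing Implicit Defensive.

(* Groups are mathcomp's (possibly infinite) groupTypes.  A groupType is a
   choiceType and its subsets are boolean predicates; under the axioms of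
   mathcomp.classical.boolp this is no restriction on groups or subgroups. *)

Local Open Scope fset_scope.
Local Open Scope group_scope.

Definition fset_inv (G : groupType) (A : {fset G}) : {fset G} :=
  [fset x^-1 | x in A].

Definition fset_lmul (G : groupType) (a : G) (A : {fset G}) : {fset G} :=
  [fset a * x | x in A].

Definition fset_rmul (G : groupType) (A : {fset G}) (a : G) : {fset G} :=
  [fset x * a | x in A].

Definition extreme_point (G : groupType) (A : {fset G}) (a : G) : bool :=
  (a \in A) && (fset_lmul a^-1 A `&` fset_rmul (fset_inv A) a == [fset 1]).

Definition diffuse (G : groupType) : Prop :=
  forall A : {fset G}, (1 < #|` A|)%N ->
  exists a b : G, [/\ a != b, extreme_point A a & extreme_point A b].

Definition nontrivial (G : groupType) : Prop := exists x : G, x != 1.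

(* The only subgroup of G containing s is G itself, i.e. s generates G. *)
Definition generates (G : groupType) (s : {fset G}) : Prop :=
  forall S : {pred G}, group_closed S -> {subset s <= S} ->
  forall x : G, x \in S.

Definition finitely_generated (G : groupType) : Prop :=
  exists s : {fset G}, generates s.

Definition surjective (aT rT : Type) (f : aT -> rT) : Prop :=
  forall y : rT, exists x : aT, f x = y.

(* Main.v *)
(* The condition that a be extreme in A says that a g and a g^-1 lie in A only
   for g = 1.  Given a homomorphism f, a point that is extreme in its fiber of
   f restricted to A, and whose image is extreme in f(A), is extreme in A.  To
   find two extreme points, translate A so that it contains 1 and map the
   subgroup generated by A onto a nontrivial diffuse group: the image of A has
   at least two points, hence two extreme ones, and the fibers above them are
   proper subsets of A, to which induction on #|A| applies. *)
Require Import Defs.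
From HB Require Import structures.
From mathcomp Require Import all_boot.
From mathcomp Require Import finmap.
From mathcomp Require Import boolp.

Set Implicit Arguments.
Unset Strict Implicit.
Unset Printing Implicit Defensive.

Local Open Scope fset_scope.
Local Open Scope group_scope.

(** An element [a^-1 * x] of the first set is a [g] with [a * g = x], and an element [y^-1 * a] of
    the second is a [g] with [a * g^-1 = y]. *)
Lemma extreme_pointP (G : groupType) (A : {fset G}) (a : G) :
  reflect (a \in A /\ forall g : G, a * g \in A -> a * g^-1 \in A -> g = 1)
          (extreme_point A a).
Proof.
apply: (iffP andP) => [[aA /eqP eA]|[aA ext]]; split=> //.
  move=> g agA agVA; apply/fset1P; rewrite -eA in_fsetI; apply/andP; split.
    by apply/imfsetP; exists (a * g); rewrite ?mulKg.
  apply/imfsetP; exists (a * g^-1)^-1; first exact: in_imfset.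
  by rewrite invgM invgK mulgVK.
apply/eqP/fsetP => g; rewrite in_fsetI in_fset1; apply/andP/eqP.
  case=> /imfsetP[x xA ->] /imfsetP[_ /imfsetP[y yA ->] e].
  apply: ext; first by rewrite mulVKg.
  by rewrite e invgM invgK mulVKg.
move=> ->; split; apply/imfsetP.
  by exists a; rewrite ?mulVg.
by exists a^-1; rewrite ?mulVg ?in_imfset.
Qed.

Lemma cardfs_gt1P (K : choiceType) (A : {fset K}) :
  reflect (exists x y : K, [/\ x != y, x \in A & y \in A]) (1 < #|` A|)%N.
Proof.
apply: (iffP idP) => [|[x [y [neq xA yA]]]].
  have [->|[x xA]] := fset_0Vmem A; first by rewrite cardfs0.
  rewrite (cardfsD1 x) xA add1n ltnS cardfs_gt0 => /fset0Pn[y].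
  by rewrite !inE => /andP[yx yA]; exists x, y; rewrite eq_sym.
by rewrite (cardfsD1 x) xA add1n ltnS (cardfsD1 y) !inE eq_sym neq yA.
Qed.

(* gmulf1 and gmulfV ask for a UMagmaMorphism structure, which is not inferred
   from {multiplicative G -> K}. *)
Lemma multiplicative1 (G K : groupType) (f : {multiplicative G -> K}) :
  f 1 = 1.
Proof. by apply: (mulgI (f 1)); rewrite -gmulfM !mulg1. Qed.

Lemma multiplicativeV (G K : groupType) (f : {multiplicative G -> K}) :
  {morph f : x / x^-1}.
Proof.
by move=> x; apply: (mulgI (f x)); rewrite -gmulfM !mulgV multiplicative1.
Qed.

Lemma extreme_point_inj (G K : groupType) (f : {multiplicative G -> K})
    (A : {fset G}) (a : G) :
  injective f -> extreme_point [fset f x | x in A] (f a) = extreme_point A a.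
Proof.
move=> fI; apply/extreme_pointP/extreme_pointP => -[aA ext].
  move: aA; rewrite (mem_imfset _ _ fI) /= => aA; split=> // g agA agVA.
  apply: (fI); rewrite multiplicative1.
  by apply: ext; rewrite -?multiplicativeV -gmulfM (mem_imfset _ _ fI).
split=> [|g /imfsetP[x xA eg] /imfsetP[y yA egV]]; first exact: in_imfset.
have ge : g = f (a^-1 * x) by rewrite gmulfM multiplicativeV -eg mulKg.
rewrite ge (ext (a^-1 * x)) ?multiplicative1 ?mulVKg //.
suff -> : a * (a^-1 * x)^-1 = y by [].
by apply: fI; rewrite gmulfM multiplicativeV -ge.
Qed.

(** The factor [g] that tests extremality acts on the right, so it commutes with left
    translation. *)
Lemma extreme_point_lmul (G : groupType) (c : G) (A : {fset G}) (a : G) :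
  extreme_point (fset_lmul c A) (c * a) = extreme_point A a.
Proof.
have mE x : (c * x \in fset_lmul c A) = (x \in A).
  by rewrite mem_imfset //; apply: mulgI.
by apply/extreme_pointP/extreme_pointP; rewrite mE => -[aA ext];
   split=> // g; move: (ext g); rewrite -?mulgA !mE.
Qed.

(** If [a * g] and [a * g^-1] are in [A], extremality of [f a] forces [f g = 1], so both elements
    lie in the fiber of [a]. *)
Lemma extreme_point_fiber (G K : groupType) (f : {multiplicative G -> K})
    (A : {fset G}) (a : G) :
  extreme_point [fset f x | x in A] (f a) ->
  extreme_point [fset x in A | f x == f a] a -> extreme_point A a.
Proof.
move=> /extreme_pointP[_ extK] /extreme_pointP[].
rewrite !inE /= => /andP[aA _] ext; apply/extreme_pointP; split=> // g agA agVA.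
have fg : f g = 1.
  by apply: extK; rewrite -?multiplicativeV -gmulfM; apply: in_imfset.
apply: ext; rewrite !inE ?agA ?agVA gmulfM ?multiplicativeV fg.
  by rewrite mulg1 /=.
by rewrite invg1 mulg1 /=.
Qed.

Lemma diffuse_inj (G K : groupType) (f : {multiplicative G -> K}) :
  injective f -> diffuse K -> diffuse G.
Proof.
move=> fI dK A; have <- : #|` [fset f x | x in A]| = #|` A|.
  by rewrite card_imfset.
move=> /dK[x [y [neq extx exty]]].
have /extreme_pointP[/imfsetP[a _ xa] _] := extx.
have /extreme_pointP[/imfsetP[b _ yb] _] := exty.
rewrite {}xa {}yb !(extreme_point_inj _ _ fI) in neq extx exty.
by exists a, b; split=> //; apply: contra_neq neq => ->.
Qed.

(** Classical logic makes this intersection of subgroups a boolean predicate, as [subGroupType]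
    requires. *)
Definition generated_pred (G : groupType) (A : {fset G}) : {pred G} :=
  fun x => `[< forall S : {pred G}, group_closed S -> {subset A <= S} ->
               x \in S >].

Lemma generated_predP (G : groupType) (A : {fset G}) (x : G) :
  reflect (forall S : {pred G}, group_closed S -> {subset A <= S} -> x \in S)
          (x \in generated_pred A).
Proof. exact: asboolP. Qed.

Lemma sub_generated (G : groupType) (A : {fset G}) :
  {subset A <= generated_pred A}.
Proof. by move=> x xA; apply/generated_predP => S _; apply. Qed.

Lemma generated_group_closed (G : groupType) (A : {fset G}) :
  group_closed (generated_pred A).
Proof.
split=> [|x y /generated_predP xA /generated_predP yA]; apply/generated_predP.
  by move=> S [].
by move=> S SG AS; apply: SG.2; [apply: xA | apply: yA].
Qed.

Definition generated (G : groupType) (A : {fset G}) : Type :=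
  {x : G | x \in generated_pred A}.

HB.instance Definition _ (G : groupType) (A : {fset G}) :=
  SubChoice.on (generated A).
HB.instance Definition _ (G : groupType) (A : {fset G}) :=
  SubChoice_isSubGroup.Build G (generated_pred A) (generated A)
    (generated_group_closed A).

Definition generators (G : groupType) (A : {fset G}) : {fset generated A} :=
  [fset Sub (val x) (sub_generated (valP x)) | x : A].

Lemma val_generators (G : groupType) (A : {fset G}) :
  [fset val x | x in generators A] = A.
Proof.
apply/fsetP => x; apply/imfsetP/idP => [[_ /imfsetP[y _ ->] ->]|xA].
  by rewrite SubK; apply: valP.
exists (Sub x (sub_generated xA)); last by rewrite SubK.
by apply/imfsetP; exists [` xA] => //; apply: val_inj; rewrite !SubK.
Qed.

Lemma generators_lift (G : groupType) (A : {fset G}) (x : G) :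
  x \in A -> exists2 u : generated A, u \in generators A & x = val u.
Proof. by rewrite -{1}(val_generators A) => /imfsetP. Qed.

Lemma generatorsP (G : groupType) (A : {fset G}) : generates (generators A).
Proof.
move=> S SG AS x.
(* [S] is extended by [false] to a subgroup of [G] containing [A], which must then contain all of
   [generated_pred A]. *)
pose T : {pred G} := fun y => if insub y is Some z then z \in S else false.
have TE (z : generated A) : (val z \in T) = (z \in S).
  by rewrite unfold_in /T valK.
have : val x \in T.
  have /generated_predP := valP x; apply.
    split; first by rewrite -(val1 (generated A)) TE SG.1.
    move=> u v; rewrite unfold_in /T.
    case: insubP => // u' _ <- u'S; rewrite [_ \in _]unfold_in.
    case: insubP => // v' _ <- v'S.
    by rewrite -multiplicativeV -gmulfM TE; apply: SG.2.
  by move=> y /generators_lift[z zA ->]; rewrite TE; apply: AS.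
by rewrite TE.
Qed.

(** Otherwise [f] sends all of [s] to [f 1 = 1]; the kernel then contains the generators, and [f] is
    trivial. *)
Lemma generates_imfset_gt1 (F H : groupType) (f : {multiplicative F -> H})
    (s : {fset F}) :
  generates s -> 1 \in s -> nontrivial H -> surjective f ->
  (1 < #|` [fset f x | x in s]|)%N.
Proof.
move=> gs s1 [h h1] fS; apply: contraT => nlt; case/eqP: h1.
have f1 x : x \in s -> f x = 1.
  move=> xs; apply: contraNeq nlt => fx1; apply/cardfs_gt1P.
  by exists (f x), (f 1); rewrite {1}multiplicative1 !in_imfset.
have [x <-] := fS h.
suff : x \in [pred y | f y == 1] by move/eqP.
apply: gs => [|y ys]; last by rewrite inE f1.
split=> [|y z]; rewrite !inE ?multiplicative1 // => /eqP fy /eqP fz.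
by rewrite gmulfM multiplicativeV fy fz invg1 mulg1.
Qed.

(** Here [F] stands for the subgroup generated by [A], [i] for its inclusion and [B] for [A] seen
    inside [F]. *)
Lemma diffuse_local (G : groupType) :
  (forall A : {fset G}, 1 \in A -> (1 < #|` A|)%N ->
     exists (F H : groupType) (i : {multiplicative F -> G})
            (f : {multiplicative F -> H}) (B : {fset F}),
       [/\ injective i, [fset i x | x in B] = A, diffuse H &
           (1 < #|` [fset f x | x in B]|)%N]) ->
  diffuse G.
Proof.
(* A fiber may be a single point, so the induction also carries one extreme point for every nonempty
   set. *)
move=> loc A; suff [_] : (A != fset0 -> exists a, extreme_point A a) /\
  ((1 < #|` A|)%N ->
    exists a b : G, [/\ a != b, extreme_point A a & extreme_point A b]) by [].
have [n] := ubnP #|` A|; elim: n A => // n IH A; rewrite ltnS => leAn.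
have two : (1 < #|` A|)%N ->
    exists a b : G, [/\ a != b, extreme_point A a & extreme_point A b].
  move=> A_gt1; have /cardfs_gt1P[c [_ [_ cA _]]] := A_gt1.
  have cardA : #|` fset_lmul c^-1 A| = #|` A|.
    by rewrite card_imfset //; apply: mulgI.
  have c1 : 1 \in fset_lmul c^-1 A by apply/imfsetP; exists c; rewrite ?mulVg.
  have [|F [H [i [f [B [iI iB dH fB]]]]]] := loc _ c1; first by rewrite cardA.
  have fiber p : extreme_point [fset f x | x in B] p ->
      exists2 b, f b = p & extreme_point A (c * i b).
    move=> extp; have /extreme_pointP[/imfsetP[b0 b0B ep] _] := extp.
    pose Bp := [fset x in B | f x == p].
    have Bp_proper : Bp `<` B.
      (* Were the fiber all of [B], [f] would be constant on [B]. *)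
      rewrite fproperEneq fset_sub andbT; apply: contraTneq fB => BpB.
      apply/cardfs_gt1P => -[u [v [neq /imfsetP[x xB eu] /imfsetP[y yB ev]]]].
      move: xB yB neq; rewrite /= -BpB !inE eu ev.
      by move=> /andP[_ /eqP ->] /andP[_ /eqP ->]; rewrite eqxx.
    (* The induction hypothesis concerns subsets of [G], hence the image under [i]. *)
    have [|+ _] := IH [fset i x | x in Bp].
      apply: leq_trans leAn; rewrite -cardA -iB !(card_imfset _ _ iI).
      exact: fproper_ltn_card.
    case=> [|x extx].
      by apply/fset0Pn; exists (i b0); rewrite in_imfset ?inE ?b0B //= ep.
    have /extreme_pointP[/imfsetP[b + eb] _] := extx.
    rewrite /= !inE => /andP[bB /eqP fb]; exists b => //.
    (* The goal is carried from [A] to its translate, then to [B], and finally to the fiber [Bp]. *)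
    rewrite -(extreme_point_lmul c^-1) mulKg -iB extreme_point_inj //.
    apply: (extreme_point_fiber (f := f)); rewrite fb //.
    by move: extx; rewrite eb extreme_point_inj.
  have [p [q [neq /fiber[b fb extb] /fiber[d fd extd]]]] := dH _ fB.
  exists (c * i b), (c * i d); split=> //.
  (* The two points are distinct because they lie over distinct points [p] and [q]. *)
  by apply: contra_neq neq => /mulgI/iI ebd; rewrite -fb -fd ebd.
split=> // /fset0Pn[a aA].
case: (ltnP 1 #|` A|) => [/two[b [_ [_ ext _]]]|leA1].
  by exists b.
have /cardfs1P[b Ab] : #|` A| == 1%N.
  by rewrite eqn_leq leA1 cardfs_gt0; apply/fset0Pn; exists a.
exists b; apply/extreme_pointP; rewrite Ab; split=> [|g]; first exact: fset11.
by move=> /fset1P e _; apply: (mulgI b); rewrite mulg1.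
Qed.

Theorem theorem1p6 (G : groupType) :
  diffuse G <->
  (forall (S : {pred G}) (F : subGroupType S),
     nontrivial F -> finitely_generated F ->
     exists (H : groupType) (f : {multiplicative F -> H}),
       [/\ nontrivial H, diffuse H & surjective f]).
Proof.
split=> [dG S F ntF _|loc].
  (* A subgroup of a diffuse group is diffuse, so [F] serves as its own quotient. *)
  exists F, idfun; split=> //; last by move=> x; exists x.
  exact: (diffuse_inj (f := val)) val_inj dG.
apply: diffuse_local => A A1 A_gt1.
pose F : subGroupType (generated_pred A) := generated A.
have gen1 : 1 \in generators A.
  have [u us u1] := generators_lift A1.
  by rewrite (_ : 1 = u) //; apply: val_inj; rewrite val1.
have ntF : nontrivial F.
  have /cardfs_gt1P[x [y [neq]]] := A_gt1.
  move=> /generators_lift[u _ xu] /generators_lift[v _ yv].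
  have [u1|] := eqVneq u 1; last by exists u.
  by exists v; apply: contra_neq neq => v1; rewrite xu yv u1 v1.
have [|H [f [ntH dH fS]]] := loc _ F ntF.
  by exists (generators A); apply: generatorsP.
exists F, H, val, f, (generators A); split=> //.
- exact: val_inj.
- exact: val_generators.
exact: generates_imfset_gt1 (@generatorsP _ A) gen1 ntH fS.
Qed.
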